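(* Let $A\in\mathbb{R}^{n\times n}$ be symmetric positive definite and $b\in\mathbb{R}^n$, and consider the gradient method $x_{j+1}=x_j-\alpha_jg_j$ applied to $\min_{x\in\mathbb{R}^n}\frac12x^{\sf T}Ax-b^{\sf T}x$, where $g_j=Ax_j-b$. Suppose that $\alpha_{k-1}=\alpha_{k-1}^{SD}$ and that $I-\alpha_{k-1}A$ is invertible. Then the stepsize $$\alpha_k^{DY}=\frac{2}{\frac{1}{\alpha_{k-1}^{SD}}+\frac{1}{\alpha_{k}^{SD}}+\sqrt{\left(\frac{1}{\alpha_{k-1}^{SD}}-\frac{1}{\alpha_{k}^{SD}}\right)^2+\frac{4\|g_k\|_2^2}{(\alpha_{k-1}^{SD}\|g_{k-1}\|_2)^2}}}$$ is a solution $\alpha_k$ of the equation $$g_{\nu_1(k)}^{\sf T}\psi_1(A)(I-\alpha_kA)g_{k}\cdot g_{\nu_2(k)}^{\sf T}\psi_2(A)(I-\alpha_kA)g_{k}=g_{\nu_1(k)}^{\sf T}\psi_3(A)(I-\alpha_kA)g_{k}\cdot g_{\nu_2(k)}^{\sf T}\psi_4(A)(I-\alpha_kA)g_{k}$$ with $\nu_1(k)=k-1$, $\nu_2(k)=k$, $\psi_1(A)=\psi_4(A)=(I-\alpha_{k-1}A)^{-1}$ and $\psi_2(A)=\psi_3(A)=I$.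
   Context: $\alpha_j^{SD}$ denotes the exact line search (steepest descent) stepsize at $x_j$, i.e. $\alpha_j^{SD}=\dfrac{g_j^{\sf T}g_j}{g_j^{\sf T}Ag_j}$. The gradients $g_{k-1},g_k$ are nonzero, so that all the quantities are defined. For a quadratic objective, the iteration gives $g_{j+1}=(I-\alpha_jA)g_j$. *)

(* Defs.v *)
From mathcomp Require Import all_boot all_order all_algebra.

Set Implicit Arguments.
Unset Strict Implicit.
Unset Printing Implicit Defensive.

Import Order.TTheory GRing.Theory Num.Theory.
Local Open Scope ring_scope.

Definition dot (R : rcfType) (n : nat) (u v : 'cV[R]_n) : R :=
  (u^T *m v) 0 0.

Definition norm2 (R : rcfType) (n : nat) (u : 'cV[R]_n) : R :=
  Num.sqrt (dot u u).

Definition symmetric_posdef (R : rcfType) (n : nat) (A : 'M[R]_n) : Prop :=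
  A^T = A /\ forall u : 'cV[R]_n, u != 0 -> 0 < dot u (A *m u).

(* Gradient of u |-> (u^T A u) / 2 - b^T u, for A symmetric. *)
Definition grad (R : rcfType) (n : nat) (A : 'M[R]_n) (b u : 'cV[R]_n) :
    'cV[R]_n :=
  A *m u - b.

Definition gradient_method (R : rcfType) (n : nat) (A : 'M[R]_n)
    (b : 'cV[R]_n) (alpha : nat -> R) (x : nat -> 'cV[R]_n) : Prop :=
  forall j : nat, x j.+1 = x j - alpha j *: grad A b (x j).

(* Minimizer of the quadratic along the ray directed by minus the gradient g. *)
Definition alphaSD (R : rcfType) (n : nat) (A : 'M[R]_n) (g : 'cV[R]_n) : R :=
  dot g g / dot g (A *m g).

(* Stepsize at the gradient g k; only meaningful for 0 < k. *)
Definition alphaDY (R : rcfType) (n : nat) (A : 'M[R]_n)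
    (g : nat -> 'cV[R]_n) (k : nat) : R :=
  let sd j := alphaSD A (g j) in
  2 / (1 / sd k.-1 + 1 / sd k +
       Num.sqrt ((1 / sd k.-1 - 1 / sd k) ^+ 2 +
                 4 * norm2 (g k) ^+ 2 /
                 (sd k.-1 * norm2 (g k.-1)) ^+ 2)).

(* The equation in the unknown stepsize a at step k; nu1 and nu2 stand for the
   values nu_1(k) and nu_2(k). *)
Definition stepsize_equation (R : rcfType) (n : nat) (A : 'M[R]_n)
    (g : nat -> 'cV[R]_n) (k nu1 nu2 : nat)
    (psi1 psi2 psi3 psi4 : 'M[R]_n -> 'M[R]_n) (a : R) : Prop :=
  let r := (1%:M - a *: A) *m g k in
  dot (g nu1) (psi1 A *m r) * dot (g nu2) (psi2 A *m r) =
  dot (g nu1) (psi3 A *m r) * dot (g nu2) (psi4 A *m r).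

(* Main.v *)
Require Import Defs.
From mathcomp Require Import all_boot all_order all_algebra ring.

Set Implicit Arguments.
Unset Strict Implicit.
Unset Printing Implicit Defensive.

Import Order.TTheory GRing.Theory Num.Theory.
Local Open Scope ring_scope.

(** Write [p], [q] for the gradients at steps [k-1] and [k], [s], [t] for the
    exact line search stepsizes there, and [B = I - s A], so that [q = B p].
    Since [B] commutes with [A], the inverse of [B] cancels against the [B]
    hidden in [q]; with the symmetry of [A], the equation for the stepsize [a] becomes
    [(p . (I - a A) p) (q . (I - a A) q) = (p . (I - a A) q)^2].
    Exact line search makes [p] and [q] orthogonal, hence
    [q . A p = q . (p - q) / s = - |q|^2 / s]; after division by
    [|p|^2 |q|^2] (see [scaled_stepsize_equation]) what is left is the quadratic
    [(1 - a / s) (1 - a / t) = a^2 c] with [c = |q|^2 / (s |p|)^2].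
    In terms of [2 / a] it reads [(2 / a - 2 / s) (2 / a - 2 / t) = 4 c],
    whose larger root is the denominator of the Dai-Yuan formula
    (see [inverse_larger_root]). *)

Section DotProduct.
Variables (R : rcfType) (n : nat).
Implicit Types (u v w : 'cV[R]_n) (A : 'M[R]_n) (a : R).

Lemma dotC u v : dot u v = dot v u.
Proof. by rewrite /dot !mxE; apply: eq_bigr => i _; rewrite !mxE mulrC. Qed.

Lemma dotBr u v w : dot u (v - w) = dot u v - dot u w.
Proof. by rewrite /dot mulmxBr !mxE. Qed.

Lemma dotZr a u v : dot u (a *: v) = a * dot u v.
Proof. by rewrite /dot -scalemxAr mxE. Qed.

Lemma dot_mulmx_sym A u v : A^T = A -> dot u (A *m v) = dot v (A *m u).
Proof. by move=> symA; rewrite dotC /dot trmx_mul symA -mulmxA. Qed.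

Lemma dot_gt0 u : u != 0 -> 0 < dot u u.
Proof.
have dotE : dot u u = \sum_i u i 0 ^+ 2.
  by rewrite /dot mxE; apply: eq_bigr => i _; rewrite mxE expr2.
have dot_ge0 : 0 <= dot u u by rewrite dotE sumr_ge0 // => i _; rewrite sqr_ge0.
apply: contra_neqT; rewrite lt_def dot_ge0 andbT negbK dotE.
rewrite psumr_eq0 => [/allP u0|i _]; last exact: sqr_ge0.
apply/matrixP => i j; rewrite ord1 mxE; apply/eqP.
by have := u0 i (mem_index_enum i); rewrite sqrf_eq0.
Qed.

Lemma norm2_sqr u : norm2 u ^+ 2 = dot u u.
Proof.
rewrite /norm2 sqr_sqrtr //; have [->|/dot_gt0/ltW //] := eqVneq u 0.
by rewrite /dot mulmx0 mxE.
Qed.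

Lemma mul_residual A a u : (1%:M - a *: A) *m u = u - a *: (A *m u).
Proof. by rewrite mulmxBl mul1mx -scalemxAl. Qed.

(** Two polynomials in [A] commute, so the inverse meets its own factor. *)
Lemma invmx_residual_cancel A (s a : R) u :
  1%:M - s *: A \in unitmx ->
  invmx (1%:M - s *: A) *m ((1%:M - a *: A) *m ((1%:M - s *: A) *m u))
  = (1%:M - a *: A) *m u.
Proof.
move=> uB.
suff comm : (1%:M - a *: A) *m (1%:M - s *: A)
          = (1%:M - s *: A) *m (1%:M - a *: A).
  by rewrite (mulmxA (1%:M - a *: A)) comm -mulmxA mulKmx.
by rewrite mulmxBl [RHS]mulmxBr mul1mx mulmx1 -scalemxAl -scalemxAr
  mulmxBl mulmxBr mul1mx mulmx1 -scalemxAl -scalemxAr.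
Qed.

Lemma alphaSD_gt0 A u : symmetric_posdef A -> u != 0 -> 0 < alphaSD A u.
Proof. by case=> _ pdA u0; rewrite divr_gt0 ?dot_gt0 ?pdA. Qed.

Lemma dot_mulmx_alphaSD A u : u != 0 ->
  dot u (A *m u) = dot u u / alphaSD A u.
Proof.
move=> u0; have /lt0r_neq0 uu0 := dot_gt0 u0; rewrite /alphaSD.
by rewrite invf_div mulrC divfK.
Qed.

(** The exact line search stops where the directional derivative vanishes. *)
Lemma exact_step_orthogonal A u : symmetric_posdef A -> u != 0 ->
  dot u (u - alphaSD A u *: (A *m u)) = 0.
Proof.
move=> pdA u0; have /lt0r_neq0 s0 := alphaSD_gt0 pdA u0.
rewrite dotBr dotZr dot_mulmx_alphaSD //.
by rewrite mulrC divfK // subrr.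
Qed.

(** Solving [v = u - s A u] for [A u] turns the mixed term into a norm. *)
Lemma exact_step_conjugacy A u (s := alphaSD A u) (v := u - s *: (A *m u)) :
  symmetric_posdef A -> u != 0 -> dot v (A *m u) = - dot v v / s.
Proof.
move=> pdA u0; have /lt0r_neq0 s0 : 0 < s := alphaSD_gt0 pdA u0.
have -> : dot v v = dot v u - s * dot v (A *m u).
  by rewrite -dotZr -dotBr.
have -> : dot v u = 0 by rewrite dotC; apply: exact_step_orthogonal.
by rewrite sub0r opprK mulrC mulKf.
Qed.

End DotProduct.

(** The reciprocal of half the larger root [D] of [(D - 2 u) (D - 2 v) = 4 c],
    rather than the textbook root of the quadratic in the unknown itself:
    this form stays meaningful when [u v = c], where the quadratic
    degenerates. *)
Lemma inverse_larger_root (R : rcfType) (u v c : R)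
    (a := 2 / (u + v + Num.sqrt ((u - v) ^+ 2 + 4 * c))) :
  0 < u -> 0 < v -> 0 <= c -> (1 - a * u) * (1 - a * v) = a ^+ 2 * c.
Proof.
move=> u0 v0 c0; rewrite /a.
set r := Num.sqrt _.
have r2 : r ^+ 2 = (u - v) ^+ 2 + 4 * c.
  by rewrite sqr_sqrtr // addr_ge0 ?sqr_ge0 // mulr_ge0.
have /lt0r_neq0 D0 : 0 < u + v + r.
  by apply: ltr_wpDr; [exact: sqrtr_ge0 | exact: addr_gt0].
have -> : (1 - 2 / (u + v + r) * u) * (1 - 2 / (u + v + r) * v)
        = (r ^+ 2 - (u - v) ^+ 2) / (u + v + r) ^+ 2 by field.
by rewrite r2; field.
Qed.

(** Dividing by [P Q], for [P = |p|^2] and [Q = |q|^2], makes the equation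
    depend only on the inverse stepsizes and on one ratio of norms. *)
Lemma scaled_stepsize_equation (R : rcfType) (P Q s t a : R) :
  0 < P -> 0 < s ->
  (1 - a * (1 / s)) * (1 - a * (1 / t)) = a ^+ 2 * (Q / (s ^+ 2 * P)) ->
  (P - a * (P / s)) * (Q - a * (Q / t)) = (a * (Q / s)) ^+ 2.
Proof.
move=> /lt0r_neq0 P0 /lt0r_neq0 s0 E.
have -> : (P - a * (P / s)) * (Q - a * (Q / t))
        = P * Q * ((1 - a * (1 / s)) * (1 - a * (1 / t))) by ring.
by rewrite E; field; rewrite s0 P0.
Qed.

Lemma grad_step (R : rcfType) (n : nat) (A : 'M[R]_n) (b : 'cV[R]_n)
    (alpha : nat -> R) (x : nat -> 'cV[R]_n) (j : nat) :
  gradient_method A b alpha x ->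
  grad A b (x j.+1) = (1%:M - alpha j *: A) *m grad A b (x j).
Proof.
move=> gm; rewrite mul_residual {1}/grad gm mulmxBr -scalemxAr.
by rewrite addrAC.
Qed.

Theorem theorem2p3 (R : rcfType) (n : nat) (A : 'M[R]_n) (b : 'cV[R]_n)
    (alpha : nat -> R) (x : nat -> 'cV[R]_n) (k : nat)
    (g := fun j : nat => grad A b (x j))
    (psiinv := fun M : 'M[R]_n => invmx (1%:M - alpha k.-1 *: M))
    (psiid := fun _ : 'M[R]_n => 1%:M) :
  symmetric_posdef A ->
  gradient_method A b alpha x ->
  (0 < k)%N ->
  g k.-1 != 0 ->
  g k != 0 ->
  alpha k.-1 = alphaSD A (g k.-1) ->
  1%:M - alpha k.-1 *: A \in unitmx ->
  stepsize_equation A g k k.-1 k psiinv psiid psiid psiinv (alphaDY A g k).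
Proof.
move=> pdA gm; case: k @psiinv => [//|k] psiinv _ p0 q0 /= sE uB.
rewrite /stepsize_equation /alphaDY /psiinv /psiid /=.
rewrite exprMn !norm2_sqr -(mulrA 4) !mul1mx.
have qE : g k.+1 = (1%:M - alpha k *: A) *m g k by exact: grad_step.
(* From here on the gradients matter only through this recurrence; keeping
   them opaque stops the linearity rewrites from splitting [A x - b]. *)
clearbody g.
have cancel a : invmx (1%:M - alpha k *: A) *m ((1%:M - a *: A) *m g k.+1)
              = (1%:M - a *: A) *m g k.
  by rewrite qE invmx_residual_cancel.
rewrite cancel.
have qE' : g k.+1 = g k - alphaSD A (g k) *: (A *m g k).
  by rewrite qE mul_residual sE.
have orth := exact_step_orthogonal pdA p0.
have conj := exact_step_conjugacy pdA p0.
rewrite -qE' in orth conj.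
have s0 := alphaSD_gt0 pdA p0; have t0 := alphaSD_gt0 pdA q0.
have P0 := dot_gt0 p0; have Q0 := dot_gt0 q0.
rewrite !mul_residual !dotBr !dotZr !dot_mulmx_alphaSD //.
rewrite (dot_mulmx_sym (g k) (g k.+1) pdA.1) (dotC (g k.+1) (g k)) orth conj.
rewrite !sub0r mulrNN -expr2 mulNr mulrN sqrrN.
apply: scaled_stepsize_equation => //.
apply: inverse_larger_root; [exact: divr_gt0 | exact: divr_gt0 |].
by apply: ltW; apply: divr_gt0 => //; apply: mulr_gt0 => //; exact: exprn_gt0.
Qed.
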